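(* Let $M,K\in\mathbb{N}$ with $M,K\ge 1$, let $b_{\mathrm{tot}}\in\mathbb{N}$, let $\zeta_1,\dots,\zeta_M>0$, let $\varrho_1,\dots,\varrho_K>0$, and let $\mathbf{R}_1,\dots,\mathbf{R}_K\in\mathbb{C}^{M\times M}$ be Hermitian positive semidefinite matrices. Put $$p_m^{\mathrm{u}}=\sum_{i=1}^{K}\varrho_i[\mathbf{R}_i]_{mm},\qquad m=1,\dots,M,$$ and assume $p_m^{\mathrm{u}}>0$ for every $m$. Consider the optimization problem $$\begin{aligned}\underset{\epsilon_1,\dots,\epsilon_M\ge 0}{\text{minimize}}\quad & \mathrm{tr}\Big(\mathbf{D}_{\epsilon}\sum_{i=1}^{K}\varrho_i\mathbf{D}_{\mathbf{R}_i}\mathbf{D}_{\epsilon}\Big)\\ \text{subject to}\quad & \sum_{m=1}^{M}\log_2\Big(\frac{\zeta_m}{\epsilon_m}\Big)\le b_{\mathrm{tot}},\end{aligned}$$ where $\mathbf{D}_{\epsilon}=\mathrm{diag}(\epsilon_1,\dots,\epsilon_M)$ and $\mathbf{D}_{\mathbf{R}_i}=\mathrm{diag}(\mathbf{R}_i)$. Then the optimal solution is given, for $m=1,\dots,M$, by $$\epsilon_m^{\mathrm{op}}=\left(2^{-b_{\mathrm{tot}}}\prod_{m'=1}^{M}\zeta_{m'}\sqrt{\frac{p_{m'}^{\mathrm{u}}}{p_m^{\mathrm{u}}}}\right)^{\frac1M},$$ and the corresponding (real-valued) bit numbers $b_m^{\mathrm{op}}$ defined through $\epsilon_m^{\mathrm{op}}=\zeta_m2^{-b_m^{\mathrm{op}}}$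 are $$b_m^{\mathrm{op}}=\frac1M\left(b_{\mathrm{tot}}+\sum_{\substack{m'=1\\ m'\ne m}}^{M}\log_2\left(\frac{\zeta_m}{\zeta_{m'}}\sqrt{\frac{p_m^{\mathrm{u}}}{p_{m'}^{\mathrm{u}}}}\right)\right).$$
   Context: For a square matrix $\mathbf{X}$, $\mathrm{diag}(\mathbf{X})$ denotes $\mathbf{X}$ with all off-diagonal entries set to zero; $\mathrm{diag}(x_1,\dots,x_M)$ is the diagonal matrix with the listed diagonal entries. The expression $\log_2(\zeta_m/\epsilon_m)$ is understood as $+\infty$ when $\epsilon_m=0$, so feasible points have all $\epsilon_m>0$. Interpretation (not needed for the statement): $\epsilon_m$ is the hardware impairment level at antenna $m$ of a base station, related to the ADC resolution $b_m$ by $\epsilon_m=\zeta_m2^{-b_m}$ (with $b_m$ relaxed to real values), $\varrho_i$ is the pilot symbol energy of user $i$, $\mathbf{R}_i$ its spatial channel correlation matrix, and the constraint is the total ADC bit budget $\sum_m b_m\le b_{\mathrm{tot}}$. *)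

(* Defs.v *)
From mathcomp Require Import all_boot all_order all_algebra.
From mathcomp Require Import all_classical all_reals all_analysis.
From mathcomp Require Import complex.
Set Implicit Arguments.
Unset Strict Implicit.
Unset Printing Implicit Defensive.
Import Order.TTheory GRing.Theory Num.Theory.
Local Open Scope ring_scope.
Local Open Scope sesquilinear_scope.
Local Open Scope complex_scope.

Definition psdmx (R : rcfType) (n : nat) (A : 'M[R[i]]_n) : Prop :=
  A \is hermsymmx /\ forall x : 'cV[R[i]]_n, 0 <= (x ^t* *m A *m x) 0 0.

Definition diag_part (T : pzRingType) (n : nat) (A : 'M[T]_n) : 'M[T]_n :=
  diag_mx (\row_m A m m).

Definition log2 (R : realType) (x : R) : R := ln x / ln 2.

(* [log2 (x / y)] for [x > 0] and [y >= 0], with value [+oo] at [y = 0];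
   the explicit test is needed because [x / 0 = 0] and [ln 0 = 0] here. *)
Definition log2_ratio (R : realType) (x y : R) : \bar R :=
  if y == 0 then +oo%E else (log2 (x / y))%:E.

(* The sum is real when the [Rmx i] are Hermitian (see [pu_complexE]), so
   taking its real part only changes its type. *)
Definition pu (R : realType) (M K : nat) (rho : 'I_K -> R)
    (Rmx : 'I_K -> 'M[R[i]]_M) (m : 'I_M) : R :=
  complex.Re (\sum_(i < K) (rho i)%:C * Rmx i m m).

Lemma pu_complexE (R : realType) (M K : nat) (rho : 'I_K -> R)
    (Rmx : 'I_K -> 'M[R[i]]_M) (m : 'I_M) :
  (forall i, psdmx (Rmx i)) ->
  (pu rho Rmx m)%:C = \sum_(i < K) (rho i)%:C * Rmx i m m.
Proof.
move=> psdR; rewrite /pu; apply: RRe_real.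
apply: rpred_sum => i _; apply: rpredM; first by rewrite complex_real.
have [/is_hermitianmxP + _] := psdR i.
move=> /matrixP /(_ m m); rewrite expr0 scale1r !mxE => eqR.
by apply/CrealP; rewrite {2}eqR.
Qed.

(* The value is complex but real; [<=] on [R[i]] only relates numbers with
   equal imaginary parts, so it is the real order here. *)
Definition objective (R : realType) (M K : nat) (rho : 'I_K -> R)
    (Rmx : 'I_K -> 'M[R[i]]_M) (eps : 'I_M -> R) : R[i] :=
  let D := diag_mx (\row_m (eps m)%:C) in
  \tr (D *m (\sum_(i < K) (rho i)%:C *: diag_part (Rmx i)) *m D).

Definition feasible (R : realType) (M btot : nat) (zeta : 'I_M -> R)
    (eps : 'I_M -> R) : Prop :=
  (forall m, 0 <= eps m) /\
  (\sum_(m < M) log2_ratio (zeta m) (eps m) <= (btot%:R)%:E)%E.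

Definition optimal_solution (R : realType) (M K btot : nat)
    (zeta : 'I_M -> R) (rho : 'I_K -> R) (Rmx : 'I_K -> 'M[R[i]]_M)
    (eps : 'I_M -> R) : Prop :=
  feasible btot zeta eps /\
  forall eps' : 'I_M -> R, feasible btot zeta eps' ->
    objective rho Rmx eps <= objective rho Rmx eps'.

Definition eps_op (R : realType) (M K btot : nat)
    (zeta : 'I_M -> R) (rho : 'I_K -> R) (Rmx : 'I_K -> 'M[R[i]]_M)
    (m : 'I_M) : R :=
  (2 ^- btot *
   \prod_(m' < M) (zeta m' * Num.sqrt (pu rho Rmx m' / pu rho Rmx m)))
    `^ (M%:R^-1).

Definition b_op (R : realType) (M K btot : nat)
    (zeta : 'I_M -> R) (rho : 'I_K -> R) (Rmx : 'I_K -> 'M[R[i]]_M)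
    (m : 'I_M) : R :=
  M%:R^-1 * (btot%:R +
    \sum_(m' < M | m' != m)
       log2 (zeta m / zeta m' * Num.sqrt (pu rho Rmx m / pu rho Rmx m'))).

(* Main.v *)
Require Import Defs.
From mathcomp Require Import all_boot all_order all_algebra.
From mathcomp Require Import all_classical all_reals all_analysis.
From mathcomp Require Import complex.
From mathcomp Require Import ring lra.
Import Order.TTheory GRing.Theory Num.Theory.
Local Open Scope ring_scope.
Local Open Scope complex_scope.

(* At a feasible point write x_m = 2 ln (eps_m / eps_m^op). All the terms
   p_m (eps_m^op)^2 equal one constant c > 0, so the objective at eps is
   c * sum_m exp x_m; the bit budget is tight at eps^op, so feasibility of eps
   reads sum_m x_m >= 0. As exp x >= 1 + x, with equality only at x = 0, the
   objective is at least c * M, with equality only at eps = eps^op. *)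

Lemma sum_expR_ge {R : realType} {n : nat} (x : 'I_n -> R) :
  0 <= \sum_(i < n) x i -> n%:R <= \sum_(i < n) expR (x i).
Proof.
move=> x_ge0; apply: (@le_trans _ _ (\sum_(i < n) (1 + x i))).
  by rewrite big_split /= sumr_const card_ord lerDl.
by apply: ler_sum => i _; exact: expR_ge1Dx.
Qed.

(** The gaps [expR (x j) - (1 + x j)] are nonnegative, and the two hypotheses force their sum to be
    at most 0. So every gap vanishes, which happens only at 0. *)
Lemma sum_expR_le {R : realType} {n : nat} (x : 'I_n -> R) :
  0 <= \sum_(i < n) x i -> \sum_(i < n) expR (x i) <= n%:R ->
  forall i, x i = 0.
Proof.
move=> x_ge0 expx_le i.
have gap_ge0 j : true -> 0 <= expR (x j) - (1 + x j).
  by rewrite subr_ge0 expR_ge1Dx.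
have : \sum_(j < n) (expR (x j) - (1 + x j)) == 0.
  rewrite eq_le sumr_ge0 // andbT sumrB big_split /= sumr_const card_ord.
  by rewrite subr_le0 (le_trans expx_le)// lerDl.
rewrite psumr_eq0// => /allP/(_ i (mem_index_enum i)) /=.
by apply: contraTeq => /expR_gt1Dx; rewrite subr_eq0 => /gt_eqF ->.
Qed.

Lemma ln_sqrt {R : realType} (x : R) : 0 <= x -> ln (Num.sqrt x) = ln x / 2.
Proof. by move=> x_ge0; rewrite -powR12_sqrt// ln_powR mulrC. Qed.

Lemma ln_prod {R : realType} {n : nat} (f : 'I_n -> R) :
  (forall i, 0 < f i) -> ln (\prod_(i < n) f i) = \sum_(i < n) ln (f i).
Proof.
move=> f_gt0; elim: n f f_gt0 => [|n IHn] f f_gt0.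
  by rewrite !big_ord0 ln1.
by rewrite !big_ord_recr/= lnM ?posrE ?prodr_gt0// IHn.
Qed.

Lemma ln2_gt0 (R : realType) : 0 < ln (2 : R).
Proof. by rewrite ln_gt0// ltr1n. Qed.

(** A zero [eps m] costs infinitely many bits and breaks the finite budget, so feasible points are
    positive and the constraint becomes linear in the logarithms. *)
Lemma feasibleE {R : realType} {M btot : nat} {zeta eps : 'I_M -> R} :
  (forall m, 0 < zeta m) ->
  feasible btot zeta eps <->
  (forall m, 0 < eps m) /\
  \sum_(m < M) (ln (zeta m) - ln (eps m)) <= btot%:R * ln 2.
Proof.
move=> zeta_gt0.
have sumE : (forall m, 0 < eps m) ->
    (\sum_(m < M) log2_ratio (zeta m) (eps m))%E =
    ((\sum_(m < M) (ln (zeta m) - ln (eps m))) / ln 2)%:E.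
  move=> eps_gt0; rewrite mulr_suml -sumEFin; apply: eq_bigr => m _.
  by rewrite /log2_ratio gt_eqF// /log2 ln_div ?posrE.
split=> [[eps_ge0 bits_le]|[eps_gt0 bits_le]].
  have eps_gt0 m : 0 < eps m.
    rewrite lt_def eps_ge0 andbT; apply/negP => eps0; move: bits_le.
    suff -> : (\sum_(m < M) log2_ratio (zeta m) (eps m))%E = +oo%E.
      by rewrite leye_eq.
    (* One infinite term decides the sum only because no term is [-oo]. *)
    apply/esum_eqyP => [j _|]; first by rewrite /log2_ratio; case: ifP.
    by exists m; split=> //; rewrite /log2_ratio eps0.
  by split=> //; move: bits_le; rewrite sumE// lee_fin ler_pdivrMr ?ln2_gt0.
split=> [m|]; first exact: ltW.
by rewrite sumE// lee_fin ler_pdivrMr ?ln2_gt0.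
Qed.

Lemma objectiveE {R : realType} {M K : nat} {rho : 'I_K -> R}
    {Rmx : 'I_K -> 'M[R[i]]_M} (eps : 'I_M -> R) :
  (forall i, psdmx (Rmx i)) ->
  objective rho Rmx eps = (\sum_(m < M) pu rho Rmx m * eps m ^+ 2)%:C.
Proof.
move=> Rmx_psd; rewrite /objective /mxtrace rmorph_sum /=.
apply: eq_bigr => m _.
rewrite mul_mx_diag mul_diag_mx !mxE summxE rmorphM rmorphXn /=.
rewrite (@pu_complexE _ _ _ rho Rmx m Rmx_psd).
under eq_bigr do rewrite !mxE eqxx mulr1n.
by rewrite mulrAC -expr2 mulrC.
Qed.

(* The part of [M * ln (eps_op m)] that does not depend on [m]. *)
Definition ln_level {R : realType} {M : nat} (btot : nat)
    (zeta q : 'I_M -> R) : R :=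
  \sum_(m < M) (ln (zeta m) + ln (q m) / 2) - btot%:R * ln 2.

Section Optimum.
Context {R : realType} {M K : nat} (btot : nat) (zeta : 'I_M -> R).
Context (rho : 'I_K -> R) (Rmx : 'I_K -> 'M[R[i]]_M).
Hypothesis M_gt0 : (0 < M)%N.
Hypothesis zeta_gt0 : forall m, 0 < zeta m.
Hypothesis Rmx_psd : forall i, psdmx (Rmx i).
Hypothesis pu_gt0 : forall m, 0 < pu rho Rmx m.

Local Notation q := (pu rho Rmx).
Local Notation e := (eps_op btot zeta rho Rmx).
Local Notation level := (ln_level btot zeta q).

Let M_neq0 : (M%:R : R) != 0. Proof. by rewrite pnatr_eq0 -lt0n. Qed.

Let factor_gt0 m m' : 0 < zeta m' * Num.sqrt (q m' / q m).
Proof. by rewrite mulr_gt0// sqrtr_gt0 divr_gt0. Qed.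

Lemma eps_op_gt0 m : 0 < e m.
Proof.
by rewrite powR_gt0// mulr_gt0 ?invr_gt0 ?exprn_gt0// prodr_gt0.
Qed.

(** Each of the [M] factors contributes [- ln (q m) / 2], and the exponent [1 / M] averages these
    copies back to a single one. *)
Lemma ln_eps_op m : ln (e m) = level / M%:R - ln (q m) / 2.
Proof.
rewrite ln_powR lnM ?posrE ?invr_gt0 ?exprn_gt0 ?prodr_gt0//.
rewrite lnV ?posrE ?exprn_gt0// lnXn// ln_prod//.
under eq_bigr => m' _.
  rewrite lnM ?posrE ?sqrtr_gt0 ?divr_gt0// ln_sqrt ?divr_ge0 1?ltW//.
  rewrite ln_div ?posrE// mulrBl addrA; over.
rewrite sumrB sumr_const card_ord /ln_level -[ln 2 *+ _]mulr_natl.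
rewrite -[(_ / 2) *+ _]mulr_natl.
by field.
Qed.

Lemma sum_ln_eps_op :
  \sum_(m < M) (ln (zeta m) - ln (e m)) = btot%:R * ln 2.
Proof.
under eq_bigr do rewrite ln_eps_op opprB addrA.
rewrite sumrB sumr_const card_ord -[(level / _) *+ _]mulr_natl /ln_level.
by field.
Qed.

Let eps_op_feasible : feasible btot zeta e.
Proof.
by apply/feasibleE => //; split; [exact: eps_op_gt0 | rewrite sum_ln_eps_op].
Qed.

(** By [ln_eps_op], [q m * e m ^+ 2] equals [expR (2 * level / M%:R)] for every [m]; this is the
    constant c. *)
Lemma sum_pu_expR (eps : 'I_M -> R) : (forall m, 0 < eps m) ->
  \sum_(m < M) q m * eps m ^+ 2 =
  expR (2 * level / M%:R) *
    \sum_(m < M) expR (2 * (ln (eps m) - ln (e m))).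
Proof.
move=> eps_gt0; rewrite mulr_sumr; apply: eq_bigr => m _.
rewrite -expRD ln_eps_op -{1}(@lnK _ (q m)) ?posrE//.
rewrite -{1}(@lnK _ (eps m)) ?posrE// -expRM_natl -expRD.
by congr expR; field.
Qed.

Let sum_expR_op :
  \sum_(m < M) expR (2 * (ln (e m) - ln (e m))) = M%:R :> R.
Proof.
under eq_bigr do rewrite subrr mulr0 expR0.
by rewrite sumr_const card_ord.
Qed.

Let feasible_excess_ge0 (eps : 'I_M -> R) : feasible btot zeta eps ->
  0 <= \sum_(m < M) 2 * (ln (eps m) - ln (e m)).
Proof.
(* The budget is replaced by the bits spent at [e], so the [ln (zeta m)] cancel in the
   difference. *)
move=> /(feasibleE zeta_gt0)[_]; rewrite -sum_ln_eps_op -subr_ge0 -sumrB => ge0.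
rewrite -mulr_sumr mulr_ge0//; apply: le_trans ge0 _.
by apply: ler_sum => m _; lra.
Qed.

Lemma optimal_solutionP (eps : 'I_M -> R) :
  optimal_solution btot zeta rho Rmx eps <-> forall m, eps m = e m.
Proof.
split=> [[eps_feas eps_min] m|/funext ->].
  have [eps_gt0 _] := (feasibleE zeta_gt0).1 eps_feas.
  (* Comparing the minimizer with [e] itself bounds its sum of exponentials by [M], the equality
     case of the inequality. *)
  have := eps_min _ eps_op_feasible.
  rewrite !objectiveE// lecR !sum_pu_expR//; last exact: eps_op_gt0.
  rewrite ler_pM2l ?expR_gt0// sum_expR_op => sum_le.
  have /eqP := sum_expR_le _ (feasible_excess_ge0 _ eps_feas) sum_le m.
  rewrite mulf_eq0 pnatr_eq0 subr_eq0 => /eqP.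
  by apply: ln_inj; rewrite posrE ?eps_op_gt0.
split=> // eps' eps'_feas.
have [eps'_gt0 _] := (feasibleE zeta_gt0).1 eps'_feas.
rewrite !objectiveE// lecR !sum_pu_expR//; last exact: eps_op_gt0.
rewrite ler_pM2l ?expR_gt0// sum_expR_op.
exact/sum_expR_ge/feasible_excess_ge0.
Qed.

(** With [a m = ln (zeta m) + ln (q m) / 2], each summand is [(a m - a m') / ln 2]. Both sides then
    equal [(a m - level / M%:R) / ln 2]. *)
Lemma b_opE m :
  b_op btot zeta rho Rmx m = (ln (zeta m) - ln (e m)) / ln 2.
Proof.
have ln2_neq0 : ln (2 : R) != 0 by rewrite gt_eqF ?ln2_gt0.
have termE m' : log2 (zeta m / zeta m' * Num.sqrt (q m / q m')) =
    ((ln (zeta m) + ln (q m) / 2) - (ln (zeta m') + ln (q m') / 2)) / ln 2.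
  rewrite /log2 lnM ?posrE ?sqrtr_gt0 ?divr_gt0//.
  rewrite ln_sqrt ?divr_ge0 1?ltW// !ln_div ?posrE//.
  by congr (_ / _); field.
rewrite /b_op (eq_bigr _ (fun m' _ => termE m')).
(* The omitted term [m' = m] vanishes. *)
have sum_neqE (F : 'I_M -> R) : F m = 0 ->
    \sum_(m' < M | m' != m) F m' = \sum_(m' < M) F m'.
  by move=> F0; rewrite [RHS](bigD1 m)//= F0 add0r.
rewrite sum_neqE; last by rewrite subrr mul0r.
rewrite -mulr_suml sumrB sumr_const card_ord -[(_ + _) *+ _]mulr_natl.
rewrite ln_eps_op /ln_level.
by field; rewrite ln2_neq0 M_neq0.
Qed.

(** Both sides of the defining equation are positive, so taking [ln] gives an equivalent equation,
    linear in [b m], whose solution is [b_opE]. *)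
Lemma bit_numbersP (b : 'I_M -> R) :
  (forall m, e m = zeta m * 2 `^ (- b m)) <->
  forall m, b m = b_op btot zeta rho Rmx m.
Proof.
have ln2_neq0 : ln (2 : R) != 0 by rewrite gt_eqF ?ln2_gt0.
have lnE m : ln (zeta m * 2 `^ (- b m)) = ln (zeta m) - b m * ln 2.
  by rewrite lnM ?posrE ?powR_gt0// ln_powR mulNr.
split=> bP m; first by rewrite b_opE bP lnE opprB addrC subrK mulfK.
apply: ln_inj; rewrite ?posrE ?eps_op_gt0 ?mulr_gt0 ?powR_gt0//.
by rewrite lnE bP b_opE divfK// opprB addrC subrK.
Qed.

End Optimum.

Theorem theorem1 (R : realType) (M K btot : nat)
    (zeta : 'I_M -> R) (rho : 'I_K -> R) (Rmx : 'I_K -> 'M[R[i]]_M)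
    (M_ge1 : (1 <= M)%N) (K_ge1 : (1 <= K)%N)
    (zeta_gt0 : forall m, 0 < zeta m)
    (rho_gt0 : forall i, 0 < rho i)
    (Rmx_psd : forall i, psdmx (Rmx i))
    (pu_gt0 : forall m, 0 < pu rho Rmx m) :
  (forall eps : 'I_M -> R,
     optimal_solution btot zeta rho Rmx eps <->
     forall m, eps m = eps_op btot zeta rho Rmx m) /\
  (forall b : 'I_M -> R,
     (forall m, eps_op btot zeta rho Rmx m = zeta m * 2 `^ (- b m)) <->
     forall m, b m = b_op btot zeta rho Rmx m).
Proof. by split=> [eps|b]; [exact: optimal_solutionP | exact: bit_numbersP]. Qed.
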